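(* Let $1<p\le2$, $p'=p/(p-1)$, and $p\le b\le p'$. Assume $\sup_{\xi}\|u_\xi\|_{L^\infty(\overline{M})}/\|v_\xi\|_{L^\infty(\overline{M})}<\infty$. Let $\varphi$ be a positive function on $\mathcal{I}$ with $M_\varphi:=\sup_{t>0}t\sum_{\xi:\,t\le\varphi(\xi)}\|v_\xi\|^2_{L^\infty(\overline{M})}<\infty$. Then for every $f\in L^p(\overline{M})$, $$\Big(\sum_{\xi\in\mathcal{I}}\big(|\mathcal{F}_{L^*}f(\xi)|\,\varphi(\xi)^{\frac1b-\frac1{p'}}\big)^b\,\|v_\xi\|_{L^\infty(\overline{M})}^{1-\frac{b}{p'}}\,\|u_\xi\|_{L^\infty(\overline{M})}^{1-\frac{b}{p}}\Big)^{1/b}\lesssim_p M_\varphi^{\frac1b-\frac1{p'}}\|f\|_{L^p(\overline{M})}.$$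
   Context: Standing setup: $\overline{M}$ is a smooth orientable manifold with (possibly empty) boundary and smooth density $dx$. $L$ is a pseudo-differential operator on its interior with boundary conditions giving discrete spectrum $\{\lambda_\xi\}_{\xi\in\mathcal{I}}$, eigenfunctions $u_\xi$ of $L$ and $v_\xi$ of $L^*$ ($L^*v_\xi=\overline{\lambda_\xi}v_\xi$), $\|u_\xi\|_{L^2}=\|v_\xi\|_{L^2}=1$, $(u_\xi,v_\eta)_{L^2}=\delta_{\xi\eta}$, $\{u_\xi\}$ a Riesz basis of $L^2(\overline{M})$, $u_\xi,v_\xi\in L^\infty$. $\mathcal{F}_{L^*}f(\xi):=\int_{\overline{M}}f(x)\overline{u_\xi(x)}\,dx$. *)

(* Defs.v *)
From HB Require Import structures.
From mathcomp Require Import all_boot all_order all_algebra.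
From mathcomp Require Import all_classical all_reals all_analysis.
From mathcomp Require Import complex.
Import Order.TTheory GRing.Theory Num.Theory.

Set Implicit Arguments.
Unset Strict Implicit.
Unset Printing Implicit Defensive.

Local Open Scope classical_set_scope.
Local Open Scope ring_scope.

Section Defs.
Context {d : measure_display} {T : measurableType d} {R : realType}.
Variable mu : {measure set T -> \bar R}.

Definition cabs (z : R[i]) : R := ComplexField.Normc.normc z.

Definition cmeasurable (f : T -> R[i]) : Prop :=
  measurable_fun [set: T] (fun x => complex.Re (f x)) /\
  measurable_fun [set: T] (fun x => complex.Im (f x)).

Definition cLnorm (q : \bar R) (f : T -> R[i]) : \bar R :=
  Lnorm mu q (fun x => (cabs (f x))%:E).

Definition cLp (q : \bar R) (f : T -> R[i]) : Prop :=
  cmeasurable f /\ (cLnorm q f < +oo)%E.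

Definition cint (f : T -> R[i]) : R[i] :=
  Complex (Rintegral mu [set: T] (fun x => complex.Re (f x)))
          (Rintegral mu [set: T] (fun x => complex.Im (f x))).

Definition L2inner (f g : T -> R[i]) : R[i] :=
  cint (fun x => f x * conjc (g x)).

(* ||f||_{L^oo} as a real number (f assumed in L^oo) *)
Definition Linfnorm (f : T -> R[i]) : R := fine (cLnorm +oo%E f).

Definition riesz_basis (I : choiceType) (u : I -> T -> R[i]) : Prop :=
  (forall xi, cLp 2%:E (u xi)) /\
  (exists A B : R, 0 < A /\ 0 < B /\
     forall (s : seq I) (c : I -> R[i]), uniq s ->
       A * \sum_(i <- s) cabs (c i) ^+ 2
         <= fine (cLnorm 2%:E (fun x => \sum_(i <- s) c i * u i x)) ^+ 2
         <= B * \sum_(i <- s) cabs (c i) ^+ 2) /\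
  (forall g, cLp 2%:E g -> forall e : R, 0 < e ->
     exists (s : seq I) (c : I -> R[i]),
       (cLnorm 2%:E (fun x => (g x - \sum_(i <- s) c i * u i x)%R) < e%:E)%E).

(* The standing assumptions on the biorthogonal system {u_xi}, {v_xi}
   (eigenfunctions of L and L^* respectively). *)
Definition biorthogonal_system (I : choiceType) (u v : I -> T -> R[i]) : Prop :=
  [/\ forall xi, cLnorm 2%:E (u xi) = 1%E /\ cLnorm 2%:E (v xi) = 1%E,
      forall xi eta, L2inner (u xi) (v eta) = (if xi == eta then 1 else 0),
      riesz_basis u &
      forall xi, cLp +oo%E (u xi) /\ cLp +oo%E (v xi)].

Definition FourierLstar (I : choiceType) (u : I -> T -> R[i]) (f : T -> R[i])
  (xi : I) : R[i] := cint (fun x => f x * conjc (u xi x)).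

Definition Mphi (I : choiceType) (v : I -> T -> R[i]) (phi : I -> R) : \bar R :=
  ereal_sup [set (t%:E * esum [set xi | (t <= phi xi)%R]
                           (fun xi => (Linfnorm (v xi) ^+ 2)%:E))%E
            | t in [set t : R | 0 < t]].

End Defs.

Definition dual_exp {R : realType} (p : R) : R := p / (p - 1).

(* Main.v *)
Require Import Defs.
From HB Require Import structures.
From mathcomp Require Import all_boot all_order all_algebra.
From mathcomp Require Import all_classical all_reals all_analysis.
From mathcomp Require Import complex.
From mathcomp Require Import measurable_realfun ess_sup_inf.
From mathcomp Require Import ring lra.
Import Order.TTheory GRing.Theory Num.Theory.
Set Implicit Arguments.
Unset Strict Implicit.
Unset Printing Implicit Defensive.
Local Open Scope classical_set_scope.
Local Open Scope ring_scope.

(* The endpoint b = p is Paley's inequality: f |-> F f / (phi |v|) is of weak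
   type (1,1) with respect to the weight (phi |v|)^2, because |F f| is at most a
   multiple of |u| |f|_1, and of type (2,2) by Bessel's inequality, which is
   dual to the upper Riesz bound. Marcinkiewicz interpolation between the two is
   carried out over dyadic heights 2^k y, so that only finite sums of integrals
   occur. The endpoint b = p' is the Hausdorff-Young inequality; it follows from
   Paley's inequality with |v| replaced by |u| and a weight phi built from the
   Fourier coefficients themselves. For fixed f the exponents are affine in b,
   so the intermediate cases are Hoelder's inequality. Everything is done on
   finite sets of indices, with constants independent of the set. *)

(** * Geometric sums over the dyadic heights [y * 2 ^+ k] *)

Section DyadicSums.
Context {R : realType}.
Implicit Types (r p a y : R) (n : nat).

Lemma powR2_gt1 r : 0 < r -> 1 < (2 : R) `^ r.
Proof. move=> r0; have := @gt0_ltr_powR R r r0 1 2; rewrite powR1 !nnegrE.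
by apply; rewrite ?ltr1n. Qed.

Lemma powR_dyadic y r n : 0 < y -> (y * 2 ^+ n) `^ r = y `^ r * (2 `^ r) ^+ n.
Proof.
move=> y0; rewrite powRM ?exprn_ge0 ?ltW//; congr (_ * _).
by rewrite -(powR_mulrn n (ler0n _ 2)) -(powR_mulrn n (powR_ge0 2 r)) powRAC.
Qed.

(** With [Q = 2 ^ r], the bound is the first omitted term over [Q - 1]. Adding one more term closes
    the induction, as [1 / (Q - 1) + 1 = Q / (Q - 1)]. *)
Lemma ler_sum_dyadic r y n : 0 < r -> 0 < y ->
  \sum_(k < n) (y * 2 ^+ k) `^ r <= (y * 2 ^+ n) `^ r / (2 `^ r - 1).
Proof.
move=> r0 y0; have Q1 := powR2_gt1 r0; set Q := 2 `^ r in Q1 *.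
have Q10 : 0 < Q - 1 by rewrite subr_gt0.
elim: n => [|n IH]; first by rewrite big_ord0 divr_ge0 ?powR_ge0 ?ltW.
rewrite big_ord_recr /= (le_trans (lerD IH (lexx _)))//.
rewrite !powR_dyadic// -/Q exprS le_eqVlt; apply/orP; left; apply/eqP.
by clearbody Q; field; rewrite gt_eqF.
Qed.

(** Induction on [n]: if the last height is below [a], the full geometric sum is compared with that
    height; otherwise its term drops out. *)
Lemma ler_sum_dyadic_below r y a n : 0 < r -> 0 < y -> 0 <= a ->
  \sum_(k < n | y * 2 ^+ k < a) (y * 2 ^+ k) `^ r
    <= 2 `^ r / (2 `^ r - 1) * a `^ r.
Proof.
move=> r0 y0 a0; have Q1 := powR2_gt1 r0; set Q := 2 `^ r in Q1 *.
have Q10 : 0 < Q - 1 by rewrite subr_gt0.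
elim: n => [|n IH].
  by rewrite big_ord0 mulr_ge0 ?powR_ge0// divr_ge0 ?powR_ge0// ltW.
rewrite big_mkcond big_ord_recr /= -big_mkcond /=.
case: ifPn => [ya|_]; last by rewrite addr0.
have le1 : \sum_(k < n | y * 2 ^+ k < a) (y * 2 ^+ k) `^ r
    <= (y * 2 ^+ n) `^ r / (Q - 1).
  apply: le_trans (ler_sum_dyadic n r0 y0).
  by rewrite big_mkcond ler_sum// => k _; case: ifP => // _; exact: powR_ge0.
apply: (le_trans (lerD le1 (lexx _))).
have -> : (y * 2 ^+ n) `^ r / (Q - 1) + (y * 2 ^+ n) `^ r
    = Q / (Q - 1) * (y * 2 ^+ n) `^ r.
  by clearbody Q; move: ((_ * _) `^ _) => z; field; rewrite gt_eqF.
apply: ler_wpM2l; first by rewrite divr_ge0 ?powR_ge0// ltW.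
rewrite ge0_ler_powR ?nnegrE ?(ltW r0)// ?(ltW ya)//.
by rewrite mulr_ge0 ?exprn_ge0// ltW.
Qed.

(** The induction peels off the lowest height and doubles [y]; with [Q = 2 ^ r] it closes by
    [1 + Q^-1 * (Q / (Q - 1)) = Q / (Q - 1)]. *)
Lemma ler_sum_dyadicN r y n : 0 < r -> 0 < y ->
  \sum_(k < n) (y * 2 ^+ k) `^ (- r) <= 2 `^ r / (2 `^ r - 1) * y `^ (- r).
Proof.
move=> r0 y0; have Q1 := powR2_gt1 r0; set Q := 2 `^ r in Q1 *.
have Q10 : 0 < Q - 1 by rewrite subr_gt0.
elim: n y y0 => [|n IH] y y0.
  by rewrite big_ord0 mulr_ge0 ?powR_ge0// divr_ge0 ?powR_ge0// ltW.
rewrite big_ord_recl /= expr0 mulr1.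
under eq_bigr do rewrite /bump /= add1n exprS mulrA.
have y20 : 0 < y * 2 by rewrite mulr_gt0.
apply: (le_trans (lerD (lexx _) (IH _ y20))).
rewrite powRM ?(ltW y0)// (powRN 2) -/Q le_eqVlt; apply/orP; left; apply/eqP.
have Q0 : 0 < Q by rewrite (lt_trans _ Q1).
clearbody Q; move: (y `^ _) => z; field.
by rewrite !gt_eqF.
Qed.

(** Doubling [y] skips heights until one reaches [a]; from there the whole sum is compared with its
    lowest term. *)
Lemma ler_sum_dyadic_above r y a n : 0 < r -> 0 < y -> 0 < a ->
  \sum_(k < n | a <= y * 2 ^+ k) (y * 2 ^+ k) `^ (- r)
    <= 2 `^ r / (2 `^ r - 1) * a `^ (- r).
Proof.
move=> r0 y0 a0; have Q1 := powR2_gt1 r0; set Q := 2 `^ r in Q1 *.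
have Q10 : 0 < Q - 1 by rewrite subr_gt0.
elim: n y y0 => [|n IH] y y0.
  by rewrite big_ord0 mulr_ge0 ?powR_ge0// divr_ge0 ?powR_ge0// ltW.
have y20 : 0 < y * 2 by rewrite mulr_gt0.
have [ay|ya] := leP a y.
  apply: (@le_trans _ _ (\sum_(k < n.+1) (y * 2 ^+ k) `^ (- r))).
    by rewrite big_mkcond ler_sum// => k _; case: ifP => // _; exact: powR_ge0.
  apply: (le_trans (ler_sum_dyadicN _ r0 y0)).
  apply: ler_wpM2l; first by rewrite divr_ge0 ?powR_ge0// ltW.
  rewrite !powRN lef_pV2 ?posrE ?powR_gt0//.
  by rewrite ge0_ler_powR ?nnegrE ?(ltW r0) ?(ltW a0) ?(ltW y0).
rewrite big_mkcond big_ord_recl /= expr0 mulr1 (leNgt a y) ya /= add0r.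
under eq_bigr do rewrite /bump /= add1n exprS mulrA.
by rewrite -(big_mkcond (fun k : 'I_n => a <= y * 2 * 2 ^+ k)) /= IH.
Qed.

(** The exponent [p - 1] serves the heights below [a], and [2 - p] those above. The denominators
    vanish at [p = 1] and [p = 2], so [p = 2] needs a separate argument. *)
Definition dyadic_cst p : R :=
  2 `^ (p - 1) / (2 `^ (p - 1) - 1) + 2 `^ (2 - p) / (2 `^ (2 - p) - 1).

Lemma dyadic_cst_gt0 p : 1 < p < 2 -> 0 < dyadic_cst p.
Proof.
move=> /andP[p1 p2]; rewrite /dyadic_cst.
have ? : 1 < (2:R) `^ (p - 1) by apply: powR2_gt1; lra.
have ? : 1 < (2:R) `^ (2 - p) by apply: powR2_gt1; lra.
by rewrite addr_gt0// divr_gt0 ?subr_gt0// powR_gt0.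
Qed.

(** Pointwise core of Marcinkiewicz interpolation, to be used with [a = |f(x)|]. The terms are
    [a * Y ^ (p - 1)] for [Y < a] and [a ^ 2 * Y ^ (p - 2)] for [Y >= a]. As [p - 1 > 0 > p - 2],
    each geometric sum is governed by the heights nearest [a] and is of order [a ^ p]. *)
Lemma ler_sum_dyadic_split p y a n : 1 < p < 2 -> 0 < y -> 0 <= a ->
  \sum_(k < n) (y * 2 ^+ k) `^ p *
     ((if y * 2 ^+ k < a then a else 0) / (y * 2 ^+ k) +
      (if a <= y * 2 ^+ k then a ^+ 2 else 0) / (y * 2 ^+ k) ^+ 2)
    <= dyadic_cst p * a `^ p.
Proof.
move=> p12; have /andP[p1 p2] := p12.
rewrite le_eqVlt => y0 /orP[/eqP <-|a0].
  rewrite big1 ?mulr_ge0 ?powR_ge0 ?(ltW (dyadic_cst_gt0 p12))// => k _.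
  by rewrite expr0n/= !if_same !mul0r addr0 mulr0.
have yk0 k : 0 < y * 2 ^+ k by rewrite mulr_gt0 ?exprn_gt0.
have p10 : 0 < p - 1 by lra.
have p20 : 0 < 2 - p by lra.
have E k : (y * 2 ^+ k) `^ p *
     ((if y * 2 ^+ k < a then a else 0) / (y * 2 ^+ k) +
      (if a <= y * 2 ^+ k then a ^+ 2 else 0) / (y * 2 ^+ k) ^+ 2)
  = a * (if y * 2 ^+ k < a then (y * 2 ^+ k) `^ (p - 1) else 0)
  + a ^+ 2 * (if a <= y * 2 ^+ k then (y * 2 ^+ k) `^ (- (2 - p)) else 0).
  move: (yk0 k); set Y := y * _ => Y0; rewrite opprB.
  have Yn0 : Y != 0 by rewrite gt_eqF.
  have P1 : Y `^ (p - 1) = Y `^ p / Y.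
    by rewrite powRB ?Yn0 ?implybT// powRr1 ?(ltW Y0).
  have P2 : Y `^ (p - 2) = Y `^ p / Y ^+ 2.
    by rewrite powRB ?Yn0 ?implybT// powR_mulrn ?(ltW Y0).
  rewrite mulrDr P1 P2; move: (Y `^ p) => Z; clear -Y0.
  by do 2 case: ifP => _; field; rewrite gt_eqF.
under eq_bigr do rewrite E.
rewrite big_split /= -!mulr_sumr -!big_mkcond /=.
have S1 := ler_sum_dyadic_below n p10 y0 (ltW a0).
have S2 := ler_sum_dyadic_above n p20 y0 a0.
apply: (le_trans (lerD (ler_wpM2l (ltW a0) S1)
  (ler_wpM2l (exprn_ge0 2 (ltW a0)) S2))).
rewrite mulrCA (mulrCA (a ^+ 2)) mulr_powRB1 ?(ltW a0)//; last by lra.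
have -> : a ^+ 2 * a `^ (- (2 - p)) = a `^ p.
  rewrite -(powR_mulrn 2 (ltW a0)) -powRD ?(gt_eqF a0) ?implybT//.
  by congr (_ `^ _); ring.
by rewrite /dyadic_cst mulrDl.
Qed.

Lemma powR_expR (x r : R) : 0 < x -> x `^ r = expR (r * ln x).
Proof. by move=> x0; rewrite /powR gt_eqF. Qed.

(** Turns Paley and Hausdorff-Young terms into powers of the ratio [a / w] against the weight
    [w ^ 2], so that level sets of the ratio can be used. *)
Lemma powR_ratio (a w q : R) : 0 <= a -> 0 < w ->
  a `^ q * w `^ (2 - q) = (a / w) `^ q * w ^+ 2.
Proof.
move=> a0 w0; rewrite powRB ?(gt_eqF w0) ?implybT// (powR_mulrn 2 (ltW w0)).
rewrite powRM ?invr_ge0 ?(ltW w0)// -(powR_inv1 (ltW w0)) -powRrM mulN1r powRN.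
by rewrite -mulrA; congr (_ * _); rewrite mulrC.
Qed.

End DyadicSums.

(** * Paley's inequality for finite families of numbers *)

Section FinitePaley.
Context {R : realType} {I : eqType}.
Implicit Types (s : seq I) (a U V phi : I -> R).

(** Finite counterpart of [Mphi <= M]. *)
Definition tail_bounded s V phi (M : R) :=
  forall t, 0 < t -> t * \sum_(i <- s | t <= phi i) V i ^+ 2 <= M.

(** Quantified over every normalised weight, because Hausdorff-Young is later obtained from a weight
    built from [a] itself. *)
Definition paley_bounded s a V (p C : R) :=
  forall phi, (forall i, i \in s -> 0 < phi i) -> tail_bounded s V phi 1 ->
  \sum_(i <- s) a i `^ p * (phi i * V i) `^ (2 - p) <= C.

Lemma ler_sum_pred (s : seq I) (P Q : pred I) (F : I -> R) :
  (forall i, i \in s -> 0 <= F i) -> {in s, forall i, P i -> Q i} ->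
  \sum_(i <- s | P i) F i <= \sum_(i <- s | Q i) F i.
Proof.
move=> F0 PQ; rewrite !(big_mkcond _ F) /= big_seq [leRHS]big_seq.
apply: ler_sum => i si; case: ifPn => [/(PQ i si) ->//|_].
by case: ifP => // _; exact: F0.
Qed.

Lemma exists_dyadic_gt s (tau : I -> R) (y : R) : 0 < y ->
  exists n, forall i, i \in s -> tau i < y * 2 ^+ n.
Proof.
move=> y0.
have big t : exists n, t < y * 2 ^+ n.
  exists (Num.bound `|t / y|).
  rewrite mulrC -ltr_pdivrMr// (le_lt_trans (ler_norm _))//.
  apply: (lt_le_trans (archi_boundP (normr_ge0 _))).
  by rewrite -natrX ler_nat ltnW// ltn_expl.
have mono m n : (m <= n)%N -> y * 2 ^+ m <= y * 2 ^+ n.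
  by move=> mn; rewrite ler_pM2l// -!natrX ler_nat leq_exp2l.
elim: s => [|j s' [n IH]]; first by exists 0%N.
have [m tm] := big (tau j); exists (maxn m n) => i; rewrite inE.
move=> /predU1P[->|si]; first by rewrite (lt_le_trans tm)// mono ?leq_maxl.
by rewrite (lt_le_trans (IH _ si))// mono ?leq_maxr.
Qed.

(** A finite family meets finitely many dyadic shells: [y] is at most every positive value and
    [y * 2 ^+ n] exceeds all values. *)
Lemma exists_dyadic s (tau : I -> R) : exists2 y : R, 0 < y & exists n,
  forall i, i \in s -> 0 < tau i ->
  exists k : 'I_n, y * 2 ^+ k <= tau i < y * 2 ^+ k.+1.
Proof.
have [y y0 ys] : exists2 y : R, 0 < y &
    forall i, i \in s -> 0 < tau i -> y <= tau i.
  elim: s => [|j s [y y0 ys]]; first by exists 1.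
  have [tj|tj] := ltP 0 (tau j).
    exists (Num.min y (tau j)); first by rewrite lt_min y0.
    move=> i; rewrite inE => /predU1P[->|si] ti.
      by rewrite ge_min lexx orbT.
    by rewrite ge_min ys.
  exists y => // i; rewrite inE => /predU1P[->|]; last exact: ys.
  by rewrite ltNge tj.
have [n ns] := exists_dyadic_gt s tau y0.
exists y => //; exists n => i si ti.
have ex : exists n, tau i < y * 2 ^+ n by exists n; exact: ns.
(* The shell starts one step before the first dyadic height above [tau i]. That height is not [y]
   itself, because [y <= tau i]. *)
case: (ex_minnP ex) => -[|k] tk kmin.
  by move: tk; rewrite expr0 mulr1 ltNge ys.
have kn : (k < n)%N by rewrite kmin// ns.
exists (Ordinal kn) => /=; rewrite tk andbT leNgt; apply/negP => /kmin.
by rewrite ltnn.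
Qed.

(** Repeated halving of [sigma]: the shell between [sigma / 2] and [sigma] contributes at most
    [sigma ^ 2 * (2 / sigma) = 2 * sigma], and the successive shells add up to at most
    [4 * sigma]. *)
Lemma weighted_tail_le s (V phi : I -> R) (sigma : R) :
  (forall i, i \in s -> 0 < phi i) ->
  tail_bounded s V phi 1 ->
  0 <= sigma ->
  \sum_(i <- s | phi i <= sigma) phi i ^+ 2 * V i ^+ 2 <= 4 * sigma.
Proof.
move=> phi0 M1; rewrite le_eqVlt => /predU1P[<-|sigma0].
  by rewrite mulr0 big_seq_cond big1// => i /andP[/phi0 pi]; rewrite leNgt pi.
(* [m] bounds the number of halvings after which no index is left; the induction runs on it. *)
have [m sm] : exists m, forall i, i \in s -> sigma < phi i * 2 ^+ m.
  have [m ms] := exists_dyadic_gt s (fun i => sigma / phi i) (@ltr01 R).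
  exists m => i si; have := ms i si.
  by rewrite mul1r ltr_pdivrMr ?phi0// mulrC.
elim: m sigma sigma0 sm => [|m IH] sigma sigma0 sm.
  rewrite big_seq_cond big1 ?mulr_ge0 ?ltW// => i /andP[/sm].
  by rewrite expr0 mulr1 ltNge => /negbTE ->.
have s2 : 0 < sigma / 2 by rewrite divr_gt0.
have IH' : \sum_(i <- s | phi i <= sigma / 2) phi i ^+ 2 * V i ^+ 2
    <= 4 * (sigma / 2).
  by apply: IH => // i /sm; rewrite exprS ltr_pdivrMr// mulrCA [_ * 2]mulrC.
have H : sigma ^+ 2 * \sum_(i <- s | sigma / 2 <= phi i) V i ^+ 2 <= 2 * sigma.
  have := M1 _ s2; set S := \sum_(_ <- _ | _) _ => SM; nra.
apply: (@le_trans _ _ (4 * (sigma / 2) + 2 * sigma)); last by lra.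
apply: (le_trans _ (lerD IH' H)).
rewrite mulr_sumr !(big_mkcond (fun i => _ <= _)) -big_split /=.
rewrite big_seq [leRHS]big_seq; apply: ler_sum => i /phi0 pi.
have h0 : 0 <= phi i ^+ 2 * V i ^+ 2 by rewrite mulr_ge0 ?sqr_ge0.
have h1 : 0 <= sigma ^+ 2 * V i ^+ 2 by rewrite mulr_ge0 ?sqr_ge0.
case: (leP (phi i) sigma) => [ps|_].
  case: (leP (phi i) (sigma / 2)) => [ps2|ps2].
    by rewrite lerDl; case: ifP.
  rewrite (ltW ps2) add0r ler_wpM2r ?sqr_ge0//.
  by rewrite ler_sqr ?nnegrE ?(ltW pi) ?(ltW sigma0).
by rewrite addr_ge0//; case: ifP.
Qed.

(* [alpha y] and [gamma y] play the role of the L^1 norm of the part of f above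
   height y and of the squared L^2 norm of the part below; on the level set
   [a / (phi * V)] ~ y_k the function is split at height y_k. *)
Lemma marcinkiewicz_seq s (p K B D : R) (a V phi : I -> R)
    (alpha gamma : R -> R) (beta : R -> I -> R) :
  0 < p -> 0 <= K ->
  (forall i, i \in s -> 0 <= a i) ->
  (forall i, i \in s -> 0 < V i) ->
  (forall i, i \in s -> 0 < phi i) ->
  tail_bounded s V phi 1 ->
  (forall y, 0 < y -> 0 <= alpha y) ->
  (forall y, 0 < y -> 0 <= gamma y) ->
  (forall y i, 0 < y -> i \in s -> a i <= K * V i * alpha y + beta y i) ->
  (forall y, 0 < y -> \sum_(i <- s) beta y i ^+ 2 <= B * gamma y) ->
  0 <= B ->
  (forall y n, 0 < y ->
    \sum_(k < n) (y * 2 ^+ k) `^ p *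
      (alpha (y * 2 ^+ k) / (y * 2 ^+ k) +
       gamma (y * 2 ^+ k) / (y * 2 ^+ k) ^+ 2) <= D) ->
  \sum_(i <- s) a i `^ p * (phi i * V i) `^ (2 - p)
    <= 2 `^ p * (8 * K + 4 * B) * D.
Proof.
move=> p0 K0 a0 V0 phi0 M1 al0 ga0 ale bele B0 HD.
pose tau i := a i / (phi i * V i).
have [y y0 [n ys]] := exists_dyadic s tau.
have yk0 k : 0 < y * 2 ^+ k by rewrite mulr_gt0 ?exprn_gt0.
pose Y k := y * 2 ^+ k.
pose E k i := Y k <= tau i < Y k.+1.
have w0 i : i \in s -> 0 < phi i * V i by move=> si; rewrite mulr_gt0 ?phi0 ?V0.
(* On the shell [E k] the term equals [tau i ^ p * (phi i * V i) ^ 2] with [tau i < 2 * Y k]; this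
   is where [2 ^ p] comes from. *)
have step1 : \sum_(i <- s) a i `^ p * (phi i * V i) `^ (2 - p)
  <= \sum_(i <- s) \sum_(k < n) (if E k i then
       2 `^ p * Y k `^ p * (phi i ^+ 2 * V i ^+ 2) else 0).
  rewrite big_seq [leRHS]big_seq; apply: ler_sum => i si.
  have term0 (k : 'I_n) : 0 <= (if E k i then
       2 `^ p * Y k `^ p * (phi i ^+ 2 * V i ^+ 2) else 0).
    by case: ifP => // _; apply: mulr_ge0; apply: mulr_ge0;
      rewrite ?powR_ge0 ?sqr_ge0.
  have := a0 i si; rewrite le_eqVlt => /predU1P[<-|ai0].
    by rewrite powR0 ?(gt_eqF p0)// mul0r; apply: sumr_ge0 => k _; exact: term0.
  have ti0 : 0 < tau i by rewrite divr_gt0// w0.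
  have [k Ek] := ys i si ti0.
  rewrite (bigD1 k)//= -[leLHS]addr0; apply: lerD; last first.
    by apply: sumr_ge0 => j _; exact: term0.
  rewrite /E /Y Ek (powR_ratio p (ltW ai0) (w0 i si)) -/(tau i) exprMn.
  apply: ler_wpM2r; first by apply: mulr_ge0; rewrite sqr_ge0.
  move: Ek => /andP[_ tk].
  rewrite -powRM// ?(ltW (yk0 k))// ge0_ler_powR ?nnegrE ?(ltW p0) ?(ltW ti0)//.
    by rewrite mulr_ge0// ltW.
  by rewrite mulrCA -exprS ltW.
apply: (le_trans step1); rewrite exchange_big /=.
have step2 (k : 'I_n) : \sum_(i <- s) (if E k i then
       2 `^ p * Y k `^ p * (phi i ^+ 2 * V i ^+ 2) else 0)
   <= 2 `^ p * (8 * K + 4 * B) *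
     (Y k `^ p * (alpha (Y k) / Y k + gamma (Y k) / Y k ^+ 2)).
  have Yk := yk0 k; rewrite -/(Y k) in Yk.
  (* Chosen so that [phi i > sigma] makes [K * V i * alpha (Y k)] at most half of
     [Y k * (phi i * V i)]. On the shell [a i] is at least the latter product, so [beta (Y k) i]
     must supply the other half. *)
  set sigma := 2 * K * alpha (Y k) / Y k.
  have sigma0 : 0 <= sigma by rewrite divr_ge0 ?(ltW Yk)// !mulr_ge0// al0.
  (* The first sum carries the weak type (1,1) estimate; the second is Chebyshev's inequality for
     the weak type (2,2) estimate. *)
  have le1 : \sum_(i <- s) (if E k i then phi i ^+ 2 * V i ^+ 2 else 0)
     <= \sum_(i <- s | phi i <= sigma) phi i ^+ 2 * V i ^+ 2
        + \sum_(i <- s) 4 / Y k ^+ 2 * beta (Y k) i ^+ 2.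
    rewrite (big_mkcond (fun i => _ <= _)) -big_split /=.
    rewrite big_seq [leRHS]big_seq; apply: ler_sum => i si.
    have b0 : 0 <= 4 / Y k ^+ 2 * beta (Y k) i ^+ 2.
      by rewrite mulr_ge0 ?sqr_ge0// divr_ge0 ?sqr_ge0.
    have v0 : 0 <= phi i ^+ 2 * V i ^+ 2 by rewrite mulr_ge0 ?sqr_ge0.
    case: ifPn => [/andP[Et _]|_]; last by rewrite addr_ge0//; case: ifP.
    case: (leP (phi i) sigma) => [_|ps]; first by rewrite lerDl.
    rewrite add0r.
    have ab := ale _ i Yk si.
    move: Et; rewrite /tau ler_pdivlMr ?w0// => Et.
    move: ps; rewrite /sigma ltr_pdivrMr// => ps.
    have Vi := V0 i si.
    have KV : K * V i * alpha (Y k) <= Y k * (phi i * V i) / 2 by nra.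
    have bl : Y k * (phi i * V i) / 2 <= beta (Y k) i by lra.
    have h0 : 0 <= Y k * (phi i * V i) / 2.
      by rewrite divr_ge0// mulr_ge0 ?ltW// w0.
    have : (Y k * (phi i * V i) / 2) ^+ 2 <= beta (Y k) i ^+ 2.
      by rewrite ler_sqr ?nnegrE// (le_trans h0).
    move=> hh; rewrite [leRHS]mulrAC ler_pdivlMr ?exprn_gt0//.
    by move: hh; rewrite !expr2; lra.
  have le2 := weighted_tail_le phi0 M1 sigma0.
  have le3 := bele _ Yk.
  have -> : \sum_(i <- s) (if E k i then
       2 `^ p * Y k `^ p * (phi i ^+ 2 * V i ^+ 2) else 0)
     = 2 `^ p * Y k `^ p * \sum_(i <- s)
         (if E k i then phi i ^+ 2 * V i ^+ 2 else 0).
    by rewrite mulr_sumr; apply: eq_bigr => i _; case: ifP => _; rewrite ?mulr0.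
  rewrite -!mulrA ler_wpM2l ?powR_ge0// [leRHS]mulrCA ler_wpM2l ?powR_ge0//.
  apply: (le_trans le1); rewrite -mulr_sumr.
  set A1 := alpha (Y k) / Y k; set G1 := gamma (Y k) / Y k ^+ 2.
  have A10 : 0 <= A1 by rewrite divr_ge0 ?al0 ?ltW.
  have G10 : 0 <= G1 by rewrite divr_ge0 ?ga0 ?sqr_ge0.
  have le4 : 4 / Y k ^+ 2 * \sum_(i <- s) beta (Y k) i ^+ 2 <= 4 * B * G1.
    apply: (@le_trans _ _ (4 / Y k ^+ 2 * (B * gamma (Y k)))).
      by rewrite ler_wpM2l// divr_ge0 ?sqr_ge0.
    by rewrite /G1 le_eqVlt; apply/orP; left; apply/eqP; ring.
  apply: (le_trans (lerD le2 le4)).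
  have -> : sigma = 2 * K * A1 by rewrite /sigma /A1; ring.
  by nra.
apply: (le_trans (ler_sum _ (fun k _ => step2 k))).
rewrite -mulr_sumr ler_wpM2l ?mulr_ge0 ?powR_ge0//; last exact: HD.
by lra.
Qed.

(** * The Hausdorff-Young inequality deduced from Paley's *)

Lemma seq_argmin s (G : I -> R) : s != [::] ->
  exists2 i, i \in s & forall j, j \in s -> G i <= G j.
Proof.
elim: s => // i [|j s] IH _.
  by exists i; rewrite ?mem_head// => k; rewrite inE => /eqP ->.
have [//|k ks kmin] := IH.
have [Gik|Gki] := leP (G i) (G k).
  exists i; rewrite ?mem_head// => l; rewrite inE => /predU1P[->//|/kmin].
  exact: le_trans.
exists k; first by rewrite inE ks orbT.
by move=> l; rewrite inE => /predU1P[->|/kmin//]; exact: ltW.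
Qed.

(** Dividing [phi] by [M] normalises the tail bound; the factor comes back with the exponent [2 - p]
    that [phi] carries. *)
Lemma paley_scale s a V phi (p C M : R) : 0 < M ->
  paley_bounded s a V p C ->
  (forall i, i \in s -> 0 < V i) ->
  (forall i, i \in s -> 0 < phi i) -> tail_bounded s V phi M ->
  \sum_(i <- s) a i `^ p * (phi i * V i) `^ (2 - p) <= M `^ (2 - p) * C.
Proof.
move=> M0 PB V0 phi0 TB.
have phiM0 i : i \in s -> 0 < phi i / M by move=> /phi0 ?; exact: divr_gt0.
have := PB _ phiM0.
have -> : \sum_(i <- s) a i `^ p * (phi i * V i) `^ (2 - p) =
  M `^ (2 - p) * \sum_(i <- s) a i `^ p * (phi i / M * V i) `^ (2 - p).
  rewrite mulr_sumr big_seq [RHS]big_seq; apply: eq_bigr => i si.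
  rewrite mulrCA -powRM ?(ltW M0)//; last by rewrite ltW// mulr_gt0 ?V0 ?phiM0.
  by congr (_ * _ `^ _); field; rewrite gt_eqF.
move=> H; apply: ler_wpM2l; rewrite ?powR_ge0//; apply: H => t t0.
have := TB (t * M) (mulr_gt0 t0 M0).
under eq_bigl do rewrite -ler_pdivlMr//.
rewrite mulrAC -ler_pdivlMr// divff ?gt_eqF//.
Qed.

(* The weight [phi] is the reciprocal of the [U ^+ 2]-mass of the superlevel
   set of [a / U] through [i], which turns Paley's inequality into
   [a / U <= C `^ p^-1 * phi `^ (1 - p^-1)]. *)
Lemma hausdorff_young_of_paley s a U (p C : R) : 1 < p <= 2 -> 0 <= C ->
  (forall i, i \in s -> 0 <= a i) -> (forall i, i \in s -> 0 < U i) ->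
  paley_bounded s a U p C ->
  \sum_(i <- s) a i `^ (dual_exp p) * U i `^ (2 - dual_exp p)
    <= C `^ (dual_exp p / p).
Proof.
move=> /andP[p1 p2] C0 a0 U0 PB; set p' := dual_exp p.
have p0 : 0 < p by lra.
have p10 : 0 < p - 1 by lra.
have p'0 : 0 < p' by rewrite divr_gt0.
pose G i := a i / U i.
have G0 i : i \in s -> 0 <= G i.
  by move=> si; rewrite divr_ge0 ?a0// ltW ?U0.
pose mass i := \sum_(j <- s | G i <= G j) U j ^+ 2.
have mass0 i : i \in s -> 0 < mass i.
  move=> si; rewrite /mass (big_rem i si)/= lexx ltr_pwDl ?exprn_gt0 ?U0//.
  by rewrite sumr_ge0// => j _; rewrite sqr_ge0.
have mass_le i j : G i <= G j -> mass j <= mass i.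
  move=> Gij; apply: ler_sum_pred => [k _|k _]; first exact: sqr_ge0.
  exact: le_trans.
pose phi i := (mass i)^-1.
have phi0 i : i \in s -> 0 < phi i by move=> si; rewrite invr_gt0 mass0.
(* Let [j] minimise [G] among the indices with [t <= phi]. These all lie in the superlevel set of
   [G] through [j], whose mass is [(phi j)^-1 <= t^-1]. *)
have TB : tail_bounded s U phi 1.
  move=> t t0.
  have [E|sN] := eqVneq [seq i <- s | t <= phi i] [::].
    by rewrite -big_filter E big_nil mulr0.
  have [j] := seq_argmin G sN; rewrite mem_filter => /andP[tphi sj] jmin.
  apply: (@le_trans _ _ (t * mass j)); last first.
    by rewrite -ler_pdivlMr ?mass0// div1r.
  rewrite ler_pM2l//; apply: ler_sum_pred => [k _|k sk tk].
    exact: sqr_ge0.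
  by apply: jmin; rewrite mem_filter tk.
have := PB _ phi0 TB.
have termE i : i \in s -> a i `^ p * (phi i * U i) `^ (2 - p) =
    G i `^ p * phi i `^ (2 - p) * U i ^+ 2.
  move=> si; rewrite (@powRM _ (phi i)) ?(ltW (phi0 _ si)) ?(ltW (U0 _ si))//.
  rewrite [LHS]mulrCA [in LHS](powR_ratio p (a0 i si) (U0 i si)).
  by rewrite [LHS]mulrCA [LHS]mulrA.
have -> : \sum_(i <- s) a i `^ p * (phi i * U i) `^ (2 - p) =
    \sum_(i <- s) G i `^ p * phi i `^ (2 - p) * U i ^+ 2.
  by rewrite big_seq [RHS]big_seq; apply: eq_bigr => i /termE.
move=> PG.
have term0 i : 0 <= G i `^ p * phi i `^ (2 - p) * U i ^+ 2.
  by apply: mulr_ge0; rewrite ?sqr_ge0// mulr_ge0 ?powR_ge0.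
(* Chebyshev: keep only the terms [j] with [G i <= G j], for which also [phi i <= phi j]. Their
   [U ^ 2]-mass is [(phi i)^-1]. *)
have weak i : i \in s -> G i `^ p * phi i `^ (1 - p) <= C.
  move=> si; apply: le_trans PG.
  have -> : G i `^ p * phi i `^ (1 - p) =
      \sum_(j <- s | G i <= G j) G i `^ p * phi i `^ (2 - p) * U j ^+ 2.
    rewrite -mulr_sumr -/(mass i) -[mass i]invrK -/(phi i) -mulrA.
    congr (_ * _); rewrite -(powR_inv1 (ltW (phi0 _ si))).
    rewrite -powRD; first by congr (_ `^ _); ring.
    by rewrite (gt_eqF (phi0 _ si)) implybT.
  apply: (@le_trans _ _ (\sum_(j <- s | G i <= G j)
      G j `^ p * phi j `^ (2 - p) * U j ^+ 2)); last first.
    by apply: ler_sum_pred.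
  rewrite big_seq_cond [leRHS]big_seq_cond; apply: ler_sum => j /andP[sj Gij].
  apply: ler_wpM2r; first exact: sqr_ge0.
  apply: ler_pM; rewrite ?powR_ge0//.
    by rewrite ge0_ler_powR ?nnegrE ?(ltW p0) ?G0.
  have [pi pj] := (ltW (phi0 i si), ltW (phi0 j sj)).
  rewrite ge0_ler_powR ?nnegrE ?subr_ge0//.
  by rewrite lef_pV2 ?posrE ?mass0// mass_le.
(* [G ^ p'] is [(G ^ p * phi ^ (1 - p)) ^ (p' / p - 1)] times [G ^ p * phi ^ (2 - p)]: the powers of
   [phi] cancel for the dual exponent. [weak] bounds the first factor, the outer exponent being
   nonnegative as [p <= 2]. *)
have strong i : i \in s -> a i `^ p' * U i `^ (2 - p') <=
    C `^ (p' / p - 1) * (G i `^ p * phi i `^ (2 - p) * U i ^+ 2).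
  move=> si; rewrite powR_ratio ?a0 ?U0// mulrA.
  apply: ler_wpM2r; first exact: sqr_ge0.
  rewrite -/(G i).
  have := G0 i si; rewrite le_eqVlt => /predU1P[<-|Gi].
    by rewrite powR0 ?(gt_eqF p'0)// powR0 ?(gt_eqF p0)// mul0r mulr0.
  have -> : G i `^ p' = (G i `^ p * phi i `^ (1 - p)) `^ (p' / p - 1)
      * (G i `^ p * phi i `^ (2 - p)).
    rewrite powRM ?powR_ge0// -!powRrM !powR_expR ?phi0// -!expRD.
    by congr expR; rewrite /p' /dual_exp; field; rewrite !gt_eqF.
  apply: ler_wpM2r; first by rewrite mulr_ge0 ?powR_ge0.
  rewrite ge0_ler_powR ?nnegrE ?mulr_ge0 ?powR_ge0 ?weak//.
  rewrite subr_ge0 ler_pdivlMr// mul1r /p' /dual_exp ler_pdivlMr//; nra.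
apply: (@le_trans _ _ (\sum_(i <- s) C `^ (p' / p - 1)
    * (G i `^ p * phi i `^ (2 - p) * U i ^+ 2))).
  by rewrite big_seq [leRHS]big_seq; apply: ler_sum.
rewrite -mulr_sumr -(@mulr_powRB1 _ _ (p' / p)) ?divr_gt0// mulrC.
by apply: ler_wpM2r; rewrite ?powR_ge0.
Qed.

(** * Interpolation between the endpoints by Hoelder's inequality *)

Lemma weighted_AGM (x y th : R) : 0 <= x -> 0 <= y -> 0 < th < 1 ->
  x `^ (1 - th) * y `^ th <= (1 - th) * x + th * y.
Proof.
move=> x0 y0 /andP[th0 th1].
have t10 : 0 < 1 - th by lra.
(* Young's inequality for the conjugate exponents [(1 - th)^-1] and [th^-1]. *)
have := @conjugate_powR R (x `^ (1 - th)) (y `^ th) (1 - th)^-1 th^-1.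
rewrite -!powRrM !divff ?gt_eqF// !powRr1// !invrK.
rewrite [x * _]mulrC [y * _]mulrC; apply; rewrite ?powR_ge0 ?invr_gt0 ?subrK//.
Qed.

(** Normalise the two sums by [A] and [B], apply the weighted arithmetic-geometric mean inequality
    termwise, and add up. *)
Lemma hoelder_interpolation s (X Y : I -> R) (A B th : R) :
  0 <= A -> 0 <= B -> 0 <= th <= 1 ->
  (forall i, i \in s -> 0 <= X i) -> (forall i, i \in s -> 0 <= Y i) ->
  \sum_(i <- s) X i <= A -> \sum_(i <- s) Y i <= B ->
  \sum_(i <- s) X i `^ (1 - th) * Y i `^ th <= A `^ (1 - th) * B `^ th.
Proof.
move=> A0 B0 /andP[th0 th1] X0 Y0 XA YB.
(* At the endpoints the conjugate exponents degenerate; one factor is then a zeroth power, equal to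
   1 even at base 0. *)
have [th00|thn0] := eqVneq th 0.
  rewrite th00 !subr0 !powRr0 mulr1 powRr1//; apply: le_trans XA.
  rewrite big_seq [leRHS]big_seq; apply: ler_sum => i si.
  by rewrite powRr0 powRr1 ?X0// mulr1.
have [th11|thn1] := eqVneq th 1.
  rewrite th11 !subrr !powRr0 mul1r powRr1//; apply: le_trans YB.
  rewrite big_seq [leRHS]big_seq; apply: ler_sum => i si.
  by rewrite powRr0 powRr1 ?Y0// mul1r.
have thp : 0 < th by rewrite lt_neqAle eq_sym thn0.
have th1p : th < 1 by rewrite lt_neqAle thn1.
have t10 : 0 < 1 - th by rewrite subr_gt0.
(* Handles [A = 0] and [B = 0], where normalisation is impossible: all terms of that sum vanish. *)
have zero (Z : I -> R) : (forall i, i \in s -> 0 <= Z i) ->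
    \sum_(i <- s) Z i <= 0 -> forall i, i \in s -> Z i = 0.
  move=> Z0 Zs i si; apply/eqP; rewrite eq_le Z0// andbT; apply: le_trans Zs.
  rewrite (big_rem i si)/= lerDl big_seq sumr_ge0// => j /mem_rem; exact: Z0.
move: A0; rewrite le_eqVlt => /predU1P[A00|A0].
  rewrite -A00 in XA *; rewrite big_seq big1 ?mulr_ge0 ?powR_ge0// => i si.
  by rewrite (zero _ X0 XA _ si) powR0 ?mul0r// gt_eqF.
move: B0; rewrite le_eqVlt => /predU1P[B00|B0].
  rewrite -B00 in YB *; rewrite big_seq big1 ?mulr_ge0 ?powR_ge0// => i si.
  by rewrite (zero _ Y0 YB _ si) (powR0 thn0) mulr0.
apply: (@le_trans _ _ (\sum_(i <- s) A `^ (1 - th) * B `^ th *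
   ((1 - th) / A * X i + th / B * Y i))).
  rewrite big_seq [leRHS]big_seq; apply: ler_sum => i si.
  have XA0 : 0 <= X i / A by rewrite divr_ge0 ?X0 ?ltW.
  have YB0 : 0 <= Y i / B by rewrite divr_ge0 ?Y0 ?ltW.
  have AMG := weighted_AGM XA0 YB0 (introT andP (conj thp th1p)).
  have -> : X i `^ (1 - th) * Y i `^ th =
      A `^ (1 - th) * B `^ th * ((X i / A) `^ (1 - th) * (Y i / B) `^ th).
    rewrite mulrACA -!powRM// ?(ltW A0) ?(ltW B0)//.
    by rewrite !(mulrC _ (_ / _)) !divfK ?gt_eqF.
  apply: ler_wpM2l; first by rewrite mulr_ge0 ?powR_ge0.
  by move: AMG; rewrite ![_ / _ * X i]mulrAC ![_ / _ * Y i]mulrAC -!mulrA.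
rewrite -mulr_sumr ler_piMr ?mulr_ge0 ?powR_ge0//.
rewrite big_split /= -!mulr_sumr.
apply: (@le_trans _ _ ((1 - th) / A * A + th / B * B)).
  apply: lerD; apply: ler_wpM2l; rewrite //.
    by rewrite divr_ge0// ltW.
  by rewrite divr_ge0// ltW.
by rewrite !divfK ?gt_eqF// subrK.
Qed.

(** Each term factors as [X ^ (1 - th) * Y ^ th], with [X] the Paley term and [Y] the
    Hausdorff-Young term; [th] is determined by [b = (1 - th) * p + th * p']. *)
Lemma hausdorff_young_paley s a U V phi (p b C M : R) :
  1 < p <= 2 -> p <= b <= dual_exp p -> 0 <= C -> 0 <= M ->
  (forall i, i \in s -> 0 <= a i) -> (forall i, i \in s -> 0 < U i) ->
  (forall i, i \in s -> 0 < V i) -> (forall i, i \in s -> 0 < phi i) ->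
  paley_bounded s a U p C -> paley_bounded s a V p C ->
  tail_bounded s V phi M ->
  \sum_(i <- s) (a i * phi i `^ (b^-1 - (dual_exp p)^-1)) `^ b
      * V i `^ (1 - b / dual_exp p) * U i `^ (1 - b / p)
    <= (M `^ (b^-1 - (dual_exp p)^-1) * C `^ p^-1) `^ b.
Proof.
move=> p12 /andP[pb bp'] C0 M0 a0 U0 V0 phi0 PU PV TB.
have [p1 p2] := andP p12.
have p0 : 0 < p by lra.
have p10 : 0 < p - 1 by lra.
have b0 : 0 < b by lra.
set p' := dual_exp p in bp' *.
have p'E : p' = p / (p - 1) by [].
have p'0 : 0 < p' by rewrite divr_gt0.
case: (altP (s =P [::])) => [->|sN]; first by rewrite big_nil powR_ge0.
(* For nonempty [s], the tail at height [t = phi i] contains [V i ^ 2 > 0], which forces [M] to be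
   positive. *)
have {M0} Mpos : 0 < M.
  case: s sN a0 U0 V0 phi0 {PU PV} TB => // i s _ _ _ V0 phi0 TB.
  have si : i \in i :: s by rewrite mem_head.
  apply: lt_le_trans (TB _ (phi0 i si)).
  rewrite mulr_gt0 ?phi0// big_cons lexx ltr_pwDl ?exprn_gt0 ?V0//.
  by apply: sumr_ge0 => j _; exact: sqr_ge0.
have PX := paley_scale Mpos PV V0 phi0 TB.
have HY := hausdorff_young_of_paley p12 C0 a0 U0 PU; rewrite -/p' in HY.
have [th [th01 thb thV thU]] : exists th, [/\ 0 <= th <= 1,
    (1 - th) * p + th * p' = b, (1 - th) * (2 - p) = 1 - b / p' &
    th * (2 - p') = 1 - b / p].
  (* The quotient [(b - p) / (p' - p)] degenerates when [p = p' = 2]; then [b = p], and [th = 0] is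
     taken. *)
  have [pp'|pp'] := eqVneq p p'.
    have p_2 : p = 2.
      move: pp'; rewrite p'E => /(congr1 ( *%R^~ (p - 1))).
      rewrite divfK ?gt_eqF// => h; nra.
    have bp : b = p by apply/eqP; rewrite eq_le pb andbT [leRHS]pp'.
    exists 0; rewrite ler01 lexx -pp' bp divff ?gt_eqF// p_2; split=> //; ring.
  have p'p : p' - p != 0 by rewrite subr_eq0 eq_sym.
  have p'p0 : 0 < p' - p.
    by rewrite lt_neqAle eq_sym p'p subr_ge0 (le_trans pb bp').
  have p2n : 2 - p != 0.
    apply: contraNneq p'p => h; apply/eqP; rewrite p'E.
    have -> : p - 1 = 1 by lra.
    by rewrite divr1 subrr.
  have p2n' : p + - p * (p - 1) != 0.
    have -> : p + - p * (p - 1) = p * (2 - p) by ring.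
    by rewrite mulf_neq0// gt_eqF.
  exists ((b - p) / (p' - p)); split.
  - apply/andP; split; last by rewrite ler_pdivrMr// mul1r lerB.
    by rewrite divr_ge0 ?(ltW p'p0)// subr_ge0.
  - by field.
  - by rewrite p'E; field; rewrite (gt_eqF p10) (gt_eqF p0).
  - by rewrite p'E; field; rewrite (gt_eqF p10) (gt_eqF p0).
have X0 i : i \in s -> 0 <= a i `^ p * (phi i * V i) `^ (2 - p).
  by rewrite mulr_ge0 ?powR_ge0.
have Y0 i : i \in s -> 0 <= a i `^ p' * U i `^ (2 - p').
  by rewrite mulr_ge0 ?powR_ge0.
have A0 : 0 <= M `^ (2 - p) * C by rewrite mulr_ge0 ?powR_ge0.
have B0 : 0 <= C `^ (p' / p) by rewrite powR_ge0.
have H := hoelder_interpolation A0 B0 th01 X0 Y0 PX HY.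
have -> : (M `^ (b^-1 - p'^-1) * C `^ p^-1) `^ b =
    (M `^ (2 - p) * C) `^ (1 - th) * (C `^ (p' / p)) `^ th.
  rewrite [in RHS](powRM _ (powR_ge0 M (2 - p)) C0) -!powRrM -mulrA.
  rewrite (powRM _ (powR_ge0 M _) (powR_ge0 C _)) -!powRrM -powRD; last first.
    (* The exponents of [C] add up to [b / p], which is nonzero, so [C = 0] is no exception. *)
    apply/implyP => /eqP E; exfalso.
    have : b / p = 0 by rewrite -E -thb; field; rewrite gt_eqF.
    by apply/eqP; rewrite mulf_neq0 ?invr_neq0 ?gt_eqF.
  congr (_ `^ _ * _ `^ _); last by rewrite -thb; field; rewrite gt_eqF.
  by rewrite [RHS]mulrC thV; field; rewrite !gt_eqF.
apply: le_trans H.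
rewrite big_seq [leRHS]big_seq; apply: ler_sum => i si.
have := a0 i si; rewrite le_eqVlt => /predU1P[<-|ai].
  by rewrite mul0r powR0 ?(gt_eqF b0)// !mul0r mulr_ge0 ?powR_ge0.
have phii := phi0 i si; have Ui := U0 i si; have Vi := V0 i si.
rewrite (powRM b (ltW ai) (powR_ge0 (phi i) _)).
rewrite (powRM (2 - p) (ltW phii) (ltW Vi)).
rewrite (powRM (1 - th) (powR_ge0 (a i) p)) ?mulr_ge0 ?powR_ge0//.
rewrite (powRM (1 - th) (powR_ge0 (phi i) _) (powR_ge0 (V i) _)).
rewrite (powRM th (powR_ge0 (a i) p') (powR_ge0 (U i) _)).
(* All bases are now positive, so both sides are exponentials and the claim is an identity of linear
   forms in the logarithms of [a i], [phi i], [V i] and [U i]. *)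
rewrite -!powRrM !powR_expR// -!expRD ler_expR le_eqVlt.
apply/orP; left; apply/eqP.
rewrite -thV -thU.
have -> : (b^-1 - p'^-1) * b = (1 - th) * (2 - p).
  by rewrite thV; field; rewrite !gt_eqF.
by rewrite -thb; ring.
Qed.

End FinitePaley.

(** * Modulus, real part and imaginary part of complex numbers *)

Section ComplexModulus.
Context {R : realType}.
Implicit Types z w : R[i].

Lemma cabsE z : cabs z = Num.sqrt (complex.Re z ^+ 2 + complex.Im z ^+ 2).
Proof. by case: z. Qed.

Lemma cabs_ge0 z : 0 <= cabs z.
Proof. by rewrite cabsE sqrtr_ge0. Qed.

Lemma cabs_sqr z : cabs z ^+ 2 = complex.Re z ^+ 2 + complex.Im z ^+ 2.
Proof. by rewrite cabsE sqr_sqrtr// addr_ge0 ?sqr_ge0. Qed.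

Lemma cabs0 : cabs (0 : R[i]) = 0.
Proof. by rewrite cabsE/= !expr0n/= addr0 sqrtr0. Qed.

Lemma cabsM z w : cabs (z * w) = cabs z * cabs w.
Proof. exact: ComplexField.Normc.normcM. Qed.

Lemma cabs_conjc z : cabs (conjc z) = cabs z.
Proof. by rewrite !cabsE; case: z => a b /=; rewrite sqrrN. Qed.

Lemma ler_Re_cabs z : `|complex.Re z| <= cabs z.
Proof.
by rewrite -sqrtr_sqr cabsE ler_wsqrtr// lerDl sqr_ge0.
Qed.

Lemma ler_Im_cabs z : `|complex.Im z| <= cabs z.
Proof.
by rewrite -sqrtr_sqr cabsE ler_wsqrtr// lerDr sqr_ge0.
Qed.

Lemma ler_cabs_ReIm z : cabs z <= `|complex.Re z| + `|complex.Im z|.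
Proof.
rewrite -(ler_pXn2r (n := 2)) ?nnegrE ?cabs_ge0 ?addr_ge0//.
rewrite cabs_sqr sqrrD !real_normK ?num_real//.
by rewrite lerD2r lerDl mulrn_wge0// mulr_ge0.
Qed.

Lemma ler_cabsD z w : cabs (z + w) <= cabs z + cabs w.
Proof. exact: le_normcD. Qed.

Lemma ReD z w : complex.Re (z + w) = complex.Re z + complex.Re w.
Proof. by case: z; case: w. Qed.

Lemma ImD z w : complex.Im (z + w) = complex.Im z + complex.Im w.
Proof. by case: z; case: w. Qed.

Lemma ReM z w : complex.Re (z * w) =
  complex.Re z * complex.Re w - complex.Im z * complex.Im w.
Proof. by case: z; case: w. Qed.

Lemma ImM z w : complex.Im (z * w) =
  complex.Re z * complex.Im w + complex.Im z * complex.Re w.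
Proof. by case: z; case: w. Qed.

Lemma Re_conjc z : complex.Re (conjc z) = complex.Re z.
Proof. by case: z. Qed.

Lemma Im_conjc z : complex.Im (conjc z) = - complex.Im z.
Proof. by case: z. Qed.

End ComplexModulus.

(** * Integrability and norms of complex-valued functions *)

Section RealIntegrals.
Context {d : measure_display} {T : measurableType d} {R : realType}.
Variable mu : {measure set T -> \bar R}.
Implicit Types (h k : T -> R) (f g : T -> R[i]).

Definition rintegrable h := mu.-integrable [set: T] (EFin \o h).

Lemma rintegrable_le h k : measurable_fun [set: T] h ->
  (forall x, `|h x| <= k x) -> rintegrable k -> rintegrable h.
Proof.
move=> mh hk; apply: le_integrable => //; first exact/measurable_EFinP.
by move=> x _ /=; rewrite lee_fin (le_trans (hk x))// ler_norm.
Qed.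

Lemma rintegrableD h k : rintegrable h -> rintegrable k ->
  rintegrable (fun x => h x + k x).
Proof. by move=> ih ik; apply: eq_integrable (integrableD _ ih ik). Qed.

Lemma rintegrableZ (c : R) h : rintegrable h -> rintegrable (fun x => c * h x).
Proof. by move=> ih; apply: eq_integrable (integrableZl _ c ih). Qed.

Lemma rintegrable_sum (J : Type) (s : seq J) (h : J -> T -> R) :
  (forall j, rintegrable (h j)) -> rintegrable (fun x => \sum_(j <- s) h j x).
Proof.
move=> ih; elim: s => [|j s IH].
  under eq_fun do rewrite big_nil; exact: integrable0.
under eq_fun do rewrite big_cons; exact: rintegrableD.
Qed.

Lemma Rintegral_sum (J : Type) (s : seq J) (h : J -> T -> R) :
  (forall j, rintegrable (h j)) ->
  Rintegral mu setT (fun x => \sum_(j <- s) h j x) =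
  \sum_(j <- s) Rintegral mu setT (h j).
Proof.
move=> ih; elim: s => [|j s IH].
  rewrite big_nil; under eq_Rintegral do rewrite big_nil.
  by rewrite Rintegral_cst// mul0r.
rewrite big_cons -IH -(RintegralD measurableT (ih j) (rintegrable_sum s ih)).
by apply: eq_Rintegral => x _; rewrite big_cons.
Qed.

Lemma cmeasurable_cabs f : cmeasurable f ->
  measurable_fun [set: T] (fun x => cabs (f x)).
Proof.
move=> [mR mI]; under eq_fun do rewrite cabsE.
have mS : measurable_fun [set: T]
    (fun x => complex.Re (f x) ^+ 2 + complex.Im (f x) ^+ 2).
  by apply: measurable_funD; exact: measurable_funX.
have ms : measurable_fun [set: R] (Num.sqrt : R -> R).
  exact: continuous_measurable_fun (@sqrt_continuous R).
exact: (measurableT_comp ms mS).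
Qed.

Lemma cmeasurableD f g : cmeasurable f -> cmeasurable g ->
  cmeasurable (fun x => f x + g x).
Proof.
move=> [fR fI] [gR gI]; split.
  by under eq_fun do rewrite ReD; exact: measurable_funD.
by under eq_fun do rewrite ImD; exact: measurable_funD.
Qed.

Lemma cmeasurableM f g : cmeasurable f -> cmeasurable g ->
  cmeasurable (fun x => f x * g x).
Proof.
move=> [fR fI] [gR gI]; split.
  under eq_fun do rewrite ReM.
  by apply: measurable_funB; exact: measurable_funM.
under eq_fun do rewrite ImM.
by apply: measurable_funD; exact: measurable_funM.
Qed.

Lemma cmeasurable_cst (c : R[i]) : cmeasurable (fun _ : T => c).
Proof. by split; exact: measurable_cst. Qed.

Lemma cmeasurable_conjc f : cmeasurable f -> cmeasurable (fun x => conjc (f x)).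
Proof.
move=> [fR fI]; split; first by under eq_fun do rewrite Re_conjc.
by under eq_fun do rewrite Im_conjc; exact: measurable_funN.
Qed.

Lemma cmeasurable_if (P : T -> bool) f g : measurable_fun [set: T] P ->
  cmeasurable f -> cmeasurable g ->
  cmeasurable (fun x => if P x then f x else g x).
Proof.
move=> mP [fR fI] [gR gI]; split.
  under eq_fun do rewrite (fun_if (@complex.Re R)); exact: measurable_fun_ifT.
under eq_fun do rewrite (fun_if (@complex.Im R)); exact: measurable_fun_ifT.
Qed.

(** Finiteness of the norm gives integrability of the power, so [fine] loses nothing and the
    estimates can be made with real integrals. *)
Lemma cLnorm_powR (q : R) f : 0 < q -> cLp mu q%:E f ->
  rintegrable (fun x => cabs (f x) `^ q) /\
  fine (cLnorm mu q%:E f) `^ q = Rintegral mu setT (fun x => cabs (f x) `^ q).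
Proof.
move=> q0 [mf ff].
have E : (\int[mu]_x ((cabs (f x) `^ q)%:E) = cLnorm mu q%:E f `^ q)%E.
  rewrite /cLnorm (poweR_Lnorm _ _ (lt0r_neq0 q0)); apply: eq_integral => x _.
  by rewrite abse_EFin poweR_EFin ger0_norm ?cabs_ge0.
split; last by rewrite /Rintegral E fine_poweR.
apply/integrableP; split.
  apply/measurable_EFinP; apply: (measurableT_comp (measurable_powR q)).
  exact: cmeasurable_cabs.
under eq_integral do rewrite /= ger0_norm ?powR_ge0//.
by rewrite E poweR_lty.
Qed.

Lemma cLp_powR (q : R) f : 0 < q -> cmeasurable f ->
  rintegrable (fun x => cabs (f x) `^ q) -> cLp mu q%:E f.
Proof.
move=> q0 mf fi; split=> //; rewrite /cLnorm unlock poweR_lty//.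
move: fi => /integrableP[_]; congr (_ < _)%E; apply: eq_integral => x _ /=.
by rewrite ger0_norm ?powR_ge0 ?ger0_norm ?cabs_ge0.
Qed.

Lemma ae_le_Linfnorm f : cLp mu +oo%E f ->
  {ae mu, forall x, cabs (f x) <= Linfnorm mu f}.
Proof.
(* On a space of measure zero the whole space serves as exceptional set; otherwise the norm is an
   essential supremum. *)
move=> [mf ff]; have [mu0|mu0] := boolP (0 < mu setT)%E; last first.
  exists setT; split => //; apply/eqP; rewrite eq_le measure_ge0 andbT.
  by rewrite leNgt.
move: ff; rewrite /Linfnorm /cLnorm unlock mu0 => ff.
set S := ess_sup _ _ in ff *.
have S0 : (0 <= S)%E.
  apply: ess_sup_gee => //; apply: nearW => x /=.
  by rewrite lee_fin.
have : {ae mu, forall x, (abse \o (fun x => (cabs (f x))%:E)) x <= S}%E.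
  exact: ess_sup_ge.
apply: filterS => x /=; rewrite ger0_norm ?cabs_ge0// -lee_fin fineK//.
by rewrite ge0_fin_numE.
Qed.

Lemma Linfnorm_ge0 f : 0 <= Linfnorm mu f.
Proof. by rewrite /Linfnorm fine_ge0// Lnorm_ge0. Qed.

(** A zero essential bound makes [f] vanish almost everywhere, and then its norm of exponent [q] is
    zero too. *)
Lemma Linfnorm_gt0 (q : R) f : 0 < q -> cLnorm mu q%:E f != 0%E ->
  cLp mu +oo%E f -> 0 < Linfnorm mu f.
Proof.
move=> q0 fq fi; rewrite lt_neqAle Linfnorm_ge0 andbT eq_sym.
apply: contra fq => /eqP U0.
have := ae_le_Linfnorm fi; rewrite U0 => ae0.
rewrite /cLnorm unlock.
suff -> : (\int[mu]_x (`|(cabs (f x))%:E| `^ q) = 0)%E.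
  by rewrite poweR0r// invr_neq0 ?gt_eqF.
rewrite (ae_eq_integral (cst 0%E)) ?integral0//.
- apply: (measurableT_comp (measurable_poweR q)).
  apply: measurableT_comp => //; apply/measurable_EFinP.
  by apply: cmeasurable_cabs; case: fi.
- apply: filterS ae0 => x fx _; have -> : cabs (f x) = 0.
    by apply/eqP; rewrite eq_le fx cabs_ge0.
  by rewrite abse0 poweR0r// gt_eqF.
Qed.

Lemma integrable_mul_bounded (U : R) f g : cmeasurable f -> cmeasurable g ->
  rintegrable (fun x => cabs (f x)) -> 
  {ae mu, forall x, cabs (g x) <= U} -> 0 <= U ->
  rintegrable (fun x => cabs (f x * g x)) /\
  Rintegral mu setT (fun x => cabs (f x * g x)) <=
    U * Rintegral mu setT (fun x => cabs (f x)).
Proof.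
move=> mf mg fi gU U0.
have mfg := cmeasurable_cabs (cmeasurableM mf mg).
have UI := rintegrableZ U fi.
have le : (\int[mu]_x (cabs (f x * g x))%:E
    <= \int[mu]_x (U * cabs (f x))%:E)%E.
  apply: ae_ge0_le_integral => //.
  - by move=> x _; rewrite lee_fin cabs_ge0.
  - exact/measurable_EFinP.
  - by move=> x _; rewrite lee_fin mulr_ge0// cabs_ge0.
  - exact: (measurable_int _ UI).
  - apply: filterS gU => x gx _.
    by rewrite lee_fin cabsM mulrC ler_wpM2r// cabs_ge0.
have fin := integrable_fin_num measurableT UI.
have I : rintegrable (fun x => cabs (f x * g x)).
  apply/integrableP; split; first exact/measurable_EFinP.
  under eq_integral do rewrite /= ger0_norm ?cabs_ge0//.
  by apply: (le_lt_trans le); rewrite ltey_eq fin.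
split=> //; rewrite -RintegralZl// /Rintegral.
by apply: fine_le => //; exact: (integrable_fin_num _ I).
Qed.

Lemma rintegrable_Re f : cmeasurable f -> rintegrable (fun x => cabs (f x)) ->
  rintegrable (fun x => complex.Re (f x)).
Proof. by move=> [mR _]; apply: rintegrable_le => // x; exact: ler_Re_cabs. Qed.

Lemma rintegrable_Im f : cmeasurable f -> rintegrable (fun x => cabs (f x)) ->
  rintegrable (fun x => complex.Im (f x)).
Proof. by move=> [_ mI]; apply: rintegrable_le => // x; exact: ler_Im_cabs. Qed.

(** The factor 2 comes from bounding real and imaginary parts separately, without a rotation of the
    integral; it only enlarges the final constant. *)
Lemma cabs_cint_le f : cmeasurable f -> rintegrable (fun x => cabs (f x)) ->
  cabs (cint mu f) <= 2 * Rintegral mu setT (fun x => cabs (f x)).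
Proof.
move=> mf fi; apply: (le_trans (ler_cabs_ReIm _)) => /=.
have half h : measurable_fun setT h -> (forall x, `|h x| <= cabs (f x)) ->
    `|Rintegral mu setT h| <= Rintegral mu setT (fun x => cabs (f x)).
  move=> mh hf; have ih := rintegrable_le mh hf fi.
  apply: (le_trans (le_normr_Rintegral measurableT ih)).
  by apply: le_Rintegral => //; exact: integrable_norm.
rewrite mulrDl mul1r; case: mf => mR mI.
by apply: lerD; apply: half => // x; [exact: ler_Re_cabs|exact: ler_Im_cabs].
Qed.

Lemma cintD f g : cmeasurable f -> cmeasurable g ->
  rintegrable (fun x => cabs (f x)) -> rintegrable (fun x => cabs (g x)) ->
  cint mu (fun x => f x + g x) = cint mu f + cint mu g.
Proof.
move=> mf mg fi gi; rewrite /cint /=.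
under eq_Rintegral do rewrite ReD.
under [X in Complex _ X]eq_Rintegral do rewrite ImD.
rewrite !RintegralD//;
  [exact: rintegrable_Im..|exact: rintegrable_Re|exact: rintegrable_Re].
Qed.

End RealIntegrals.

(** * Bessel's inequality from the upper Riesz bound *)

Lemma Re_mul_conjcM {R : realType} (z c w : R[i]) :
  complex.Re (z * conjc (c * w)) =
  complex.Re c * complex.Re (z * conjc w) +
  complex.Im c * complex.Im (z * conjc w).
Proof. by case: z c w => [z1 z2] [c1 c2] [w1 w2] /=; ring. Qed.

Lemma Re_conjcM {R : realType} (c z : R[i]) :
  complex.Re (conjc c * z) =
  complex.Re c * complex.Re z + complex.Im c * complex.Im z.
Proof. by case: c z => [c1 c2] [z1 z2] /=; ring. Qed.

Section Bessel.
Context {d : measure_display} {T : measurableType d} {R : realType}.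
Variable mu : {measure set T -> \bar R}.
Implicit Types (f g h : T -> R[i]).
Local Notation rint := (rintegrable mu).

Definition square_integrable f :=
  cmeasurable f /\ rint (fun x => cabs (f x) ^+ 2).

Lemma cabs_powR2 f : (fun x => cabs (f x) `^ 2) = (fun x => cabs (f x) ^+ 2).
Proof. by apply/funext => x; rewrite powR_mulrn ?cabs_ge0. Qed.

Lemma square_integrableP f : square_integrable f <-> cLp mu 2%:E f.
Proof.
split=> [[mf fi]|fL].
  by apply: cLp_powR => //; rewrite cabs_powR2.
have [mf _] := fL; split=> //.
by have [+ _] := cLnorm_powR (ltr0n _ 2) fL; rewrite cabs_powR2.
Qed.

Lemma cLnorm2_sqr f : square_integrable f ->
  fine (cLnorm mu 2%:E f) ^+ 2 = Rintegral mu setT (fun x => cabs (f x) ^+ 2).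
Proof.
move=> /square_integrableP fL.
have [_] := cLnorm_powR (ltr0n _ 2) fL.
by rewrite cabs_powR2 powR_mulrn// fine_ge0// Lnorm_ge0.
Qed.

Lemma square_integrableD f g : square_integrable f -> square_integrable g ->
  square_integrable (fun x => f x + g x).
Proof.
move=> [mf fi] [mg gi]; split; first exact: cmeasurableD.
apply: (@rintegrable_le _ _ _ _ _
  (fun x => 2 * cabs (f x) ^+ 2 + 2 * cabs (g x) ^+ 2)).
- by apply: measurable_funX; apply: cmeasurable_cabs; exact: cmeasurableD.
- move=> x; rewrite ger0_norm ?sqr_ge0//.
  have h1 := ler_cabsD (f x) (g x).
  have h2 := cabs_ge0 (f x + g x).
  have h3 := sqr_ge0 (cabs (f x) - cabs (g x)).
  by rewrite !expr2 in h3 *; nra.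
- by apply: rintegrableD; exact: rintegrableZ.
Qed.

Lemma square_integrableZ (c : R[i]) f : square_integrable f ->
  square_integrable (fun x => c * f x).
Proof.
move=> [mf fi]; split.
  by apply: cmeasurableM => //; exact: cmeasurable_cst.
under eq_fun do rewrite cabsM exprMn.
exact: rintegrableZ.
Qed.

Lemma square_integrable_sum (J : Type) (s : seq J) (h : J -> T -> R[i]) :
  (forall j, square_integrable (h j)) ->
  square_integrable (fun x => \sum_(j <- s) h j x).
Proof.
move=> ih; elim: s => [|j s IH].
  under eq_fun do rewrite big_nil.
  split; first exact: cmeasurable_cst.
  rewrite cabs0 expr0n; exact: integrable0.
by under eq_fun do rewrite big_cons; exact: square_integrableD.
Qed.

Lemma square_integrable_mul f g : square_integrable f -> square_integrable g ->
  rint (fun x => cabs (f x * conjc (g x))).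
Proof.
move=> [mf fi] [mg gi].
apply: (@rintegrable_le _ _ _ _ _ (fun x => cabs (f x) ^+ 2 + cabs (g x) ^+ 2)).
- apply: cmeasurable_cabs; apply: cmeasurableM => //.
  exact: cmeasurable_conjc.
- move=> x; rewrite ger0_norm ?cabs_ge0// cabsM cabs_conjc.
  have h1 := cabs_ge0 (f x); have h2 := cabs_ge0 (g x).
  by rewrite !expr2; nra.
- exact: rintegrableD.
Qed.

Variable I : choiceType.
Variable u : I -> T -> R[i].

(** Taking real parts reduces the pairing to real linearity of the integral. When [c] is the family
    of Fourier coefficients of [f], the right-hand side is the sum of their squared moduli. *)
Lemma Re_cint_sum (s : seq I) (c : I -> R[i]) f :
  square_integrable f -> (forall i, square_integrable (u i)) ->
  Rintegral mu setT
    (fun x => complex.Re (f x * conjc (\sum_(i <- s) c i * u i x))) =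
  \sum_(i <- s) complex.Re (conjc (c i) * FourierLstar mu u f i).
Proof.
move=> f2 u2.
have fu i : rint (fun x => complex.Re (f x * conjc (u i x))).
  apply: rintegrable_Re; last exact: square_integrable_mul.
  apply: cmeasurableM; first by case: f2.
  by apply: cmeasurable_conjc; case: (u2 i).
have fui i : rint (fun x => complex.Im (f x * conjc (u i x))).
  apply: rintegrable_Im; last exact: square_integrable_mul.
  apply: cmeasurableM; first by case: f2.
  by apply: cmeasurable_conjc; case: (u2 i).
pose h i x := complex.Re (c i) * complex.Re (f x * conjc (u i x))
  + complex.Im (c i) * complex.Im (f x * conjc (u i x)).
have ih i : rint (h i) by apply: rintegrableD; exact: rintegrableZ.
transitivity (Rintegral mu setT (fun x => \sum_(i <- s) h i x)).
  apply: eq_Rintegral => x _; rewrite rmorph_sum mulr_sumr.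
  elim: s => [|i s IH]; first by rewrite !big_nil.
  rewrite !big_cons ReD IH; congr (_ + _).
  exact: Re_mul_conjcM.
rewrite Rintegral_sum//; apply: eq_bigr => i _.
rewrite RintegralD//; [|exact: rintegrableZ..].
rewrite (RintegralZl _ measurableT (fu i)) (RintegralZl _ measurableT (fui i)).
by rewrite Re_conjcM.
Qed.

(** Duality: pair [f] with [g], the combination of the [u i] whose coefficients are those of [f].
    The pairing is the sum [S] to be bounded, and the Riesz bound controls the squared norm of [g]
    by [B * S]. *)
Lemma bessel (B : R) (s : seq I) f : 0 < B ->
  (forall i, square_integrable (u i)) ->
  (forall (s : seq I) (c : I -> R[i]), uniq s ->
     fine (cLnorm mu 2%:E (fun x => \sum_(i <- s) c i * u i x)) ^+ 2
       <= B * \sum_(i <- s) cabs (c i) ^+ 2) ->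
  uniq s -> square_integrable f ->
  \sum_(i <- s) cabs (FourierLstar mu u f i) ^+ 2
    <= B * Rintegral mu setT (fun x => cabs (f x) ^+ 2).
Proof.
move=> B0 u2 HB us f2; set c := FourierLstar mu u f.
pose g x := \sum_(i <- s) c i * u i x.
have g2 : square_integrable g.
  by apply: square_integrable_sum => i; exact: square_integrableZ.
have := HB s c us; rewrite cLnorm2_sqr//; set G := Rintegral _ _ _.
set S := \sum_(i <- s) _; set F := Rintegral _ _ _ => GS.
have SE : S = Rintegral mu setT (fun x => complex.Re (f x * conjc (g x))).
  rewrite Re_cint_sum//; apply: eq_bigr => i _.
  by rewrite cabs_sqr Re_conjcM !expr2.
(* Weighted arithmetic-geometric mean in place of Cauchy-Schwarz; with weight [B] the second term is
   at most [S / 2] and is absorbed on the left. *)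
have : S <= B / 2 * F + B^-1 / 2 * G.
  have iF := rintegrableZ (B / 2) f2.2; have iG := rintegrableZ (B^-1 / 2) g2.2.
  rewrite SE /F /G -(RintegralZl _ measurableT f2.2).
  rewrite -(RintegralZl _ measurableT g2.2).
  rewrite -(RintegralD measurableT iF iG).
  apply: le_Rintegral => //.
  - apply: rintegrable_Re; last exact: square_integrable_mul.
    by apply: cmeasurableM; [case: f2|apply: cmeasurable_conjc; case: g2].
  - exact: rintegrableD.
  - move=> x _; apply: (le_trans (le_trans (ler_norm _) (ler_Re_cabs _))).
    rewrite cabsM cabs_conjc.
    set a := cabs (f x); set b := cabs (g x).
    have -> : B / 2 * a ^+ 2 + B^-1 / 2 * b ^+ 2 =
        a * b + B^-1 / 2 * (B * a - b) ^+ 2 by field; rewrite gt_eqF.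
    by rewrite lerDl mulr_ge0 ?sqr_ge0// divr_ge0// invr_ge0 ltW.
have : B^-1 / 2 * G <= B^-1 / 2 * (B * S).
  by apply: ler_wpM2l => //; rewrite divr_ge0// invr_ge0 ltW.
have -> : B^-1 / 2 * (B * S) = S / 2 by field; rewrite gt_eqF.
lra.
Qed.

End Bessel.

(** * Truncation of a function at a given height *)

Section Truncation.
Context {d : measure_display} {T : measurableType d} {R : realType}.
Variable mu : {measure set T -> \bar R}.
Implicit Types (f : T -> R[i]) (y p : R).
Local Notation rint := (rintegrable mu).

Definition high y f x : R[i] := if y < cabs (f x) then f x else 0.
Definition low y f x : R[i] := if cabs (f x) <= y then f x else 0.

Lemma high_low y f x : f x = high y f x + low y f x.
Proof. by rewrite /high /low; case: leP; rewrite ?add0r ?addr0. Qed.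

Lemma cmeasurable_high y f : cmeasurable f -> cmeasurable (high y f).
Proof.
move=> mf; apply: (cmeasurable_if (P := fun x => y < cabs (f x))
  _ mf (cmeasurable_cst 0)).
by apply: measurable_fun_ltr => //; exact: cmeasurable_cabs.
Qed.

Lemma cmeasurable_low y f : cmeasurable f -> cmeasurable (low y f).
Proof.
move=> mf; apply: (cmeasurable_if (P := fun x => cabs (f x) <= y)
  _ mf (cmeasurable_cst 0)).
by apply: measurable_fun_ler => //; exact: cmeasurable_cabs.
Qed.

Lemma cabs_high y f x :
  cabs (high y f x) = if y < cabs (f x) then cabs (f x) else 0.
Proof. by rewrite /high; case: ifP; rewrite ?cabs0. Qed.

Lemma cabs_low_sqr y f x :
  cabs (low y f x) ^+ 2 = if cabs (f x) <= y then cabs (f x) ^+ 2 else 0.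
Proof. by rewrite /low; case: ifP; rewrite ?cabs0 ?expr0n. Qed.

(** Where [|f| > y], one has [|f| <= y ^ (1 - p) * |f| ^ p]. *)
Lemma rintegrable_high y p f : 1 < p -> 0 < y -> cmeasurable f ->
  rint (fun x => cabs (f x) `^ p) -> rint (fun x => cabs (high y f x)).
Proof.
move=> p1 y0 mf fi.
apply: (@rintegrable_le _ _ _ _ _ (fun x => y `^ (1 - p) * cabs (f x) `^ p)).
- by apply: cmeasurable_cabs; exact: cmeasurable_high.
- move=> x; rewrite ger0_norm ?cabs_ge0// cabs_high.
  case: ifPn => [yf|_]; last by rewrite mulr_ge0 ?powR_ge0.
  have f0 : 0 < cabs (f x) by rewrite (lt_trans y0).
  rewrite -opprB powRN mulrC ler_pdivlMr ?powR_gt0//.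
  rewrite -(@mulr_powRB1 _ (cabs (f x)) p) ?(ltW f0) ?(lt_trans _ p1)//.
  apply: ler_wpM2l; first exact: ltW.
  by rewrite ge0_ler_powR ?nnegrE ?(ltW y0) ?(ltW f0) ?(ltW yf)// subr_ge0 ltW.
- exact: rintegrableZ.
Qed.

(** Where [|f| <= y], one has [|f| ^ 2 <= y ^ (2 - p) * |f| ^ p]. *)
Lemma square_integrable_low y p f : 0 < p <= 2 -> 0 < y -> cmeasurable f ->
  rint (fun x => cabs (f x) `^ p) -> square_integrable mu (low y f).
Proof.
move=> /andP[p0 p2] y0 mf fi; split; first exact: cmeasurable_low.
apply: (@rintegrable_le _ _ _ _ _ (fun x => y `^ (2 - p) * cabs (f x) `^ p)).
- by apply: measurable_funX; apply: cmeasurable_cabs; exact: cmeasurable_low.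
- move=> x; rewrite ger0_norm ?sqr_ge0// cabs_low_sqr.
  case: ifPn => [fy|_]; last by rewrite mulr_ge0 ?powR_ge0.
  have := cabs_ge0 (f x); rewrite le_eqVlt => /predU1P[<-|f0].
    by rewrite expr0n/= mulr_ge0 ?powR_ge0.
  rewrite -(powR_mulrn 2 (ltW f0)) -{1}(subrK p 2%:R) powRD; last first.
    by rewrite (gt_eqF f0) implybT.
  apply: ler_wpM2r; first exact: powR_ge0.
  by rewrite ge0_ler_powR ?nnegrE ?subr_ge0 ?(ltW y0) ?(ltW f0).
- exact: rintegrableZ.
Qed.

End Truncation.

(** * Paley's inequality for the Fourier coefficients *)

Section Paley.
Context {d : measure_display} {T : measurableType d} {R : realType}.
Variable mu : {measure set T -> \bar R}.
Variables (I : choiceType) (u : I -> T -> R[i]).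
Local Notation rint := (rintegrable mu).

(** The finite sum is moved under the integral, where [ler_sum_dyadic_split] applies at each point
    with [a = |f(x)|]. *)
Lemma dyadic_truncation_le (p y : R) (n : nat) (f : T -> R[i]) :
  1 < p < 2 -> 0 < y -> cmeasurable f -> rint (fun x => cabs (f x) `^ p) ->
  \sum_(k < n) (y * 2 ^+ k) `^ p *
    (Rintegral mu setT (fun x => cabs (high (y * 2 ^+ k) f x)) / (y * 2 ^+ k) +
     Rintegral mu setT (fun x => cabs (low (y * 2 ^+ k) f x) ^+ 2)
       / (y * 2 ^+ k) ^+ 2)
  <= dyadic_cst p * Rintegral mu setT (fun x => cabs (f x) `^ p).
Proof.
move=> p12 y0 mf fi; have /andP[p1 p2] := p12.
have yk0 k : 0 < y * 2 ^+ k by rewrite mulr_gt0 ?exprn_gt0.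
have p02 : 0 < p <= 2 by rewrite (lt_trans _ p1)//= ltW.
pose h (k : 'I_n) x := (y * 2 ^+ k) `^ p *
     ((y * 2 ^+ k)^-1 * cabs (high (y * 2 ^+ k) f x) +
      ((y * 2 ^+ k) ^+ 2)^-1 * cabs (low (y * 2 ^+ k) f x) ^+ 2).
have ihi (k : 'I_n) := rintegrable_high p1 (yk0 k) mf fi.
have ilo (k : 'I_n) := (square_integrable_low p02 (yk0 k) mf fi).2.
have ih k : rint (h k).
  by apply: rintegrableZ; apply: rintegrableD; exact: rintegrableZ.
have -> : \sum_(k < n) (y * 2 ^+ k) `^ p *
    (Rintegral mu setT (fun x => cabs (high (y * 2 ^+ k) f x)) / (y * 2 ^+ k) +
     Rintegral mu setT (fun x => cabs (low (y * 2 ^+ k) f x) ^+ 2)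
       / (y * 2 ^+ k) ^+ 2) = Rintegral mu setT (fun x => \sum_(k < n) h k x).
  rewrite Rintegral_sum//; apply: eq_bigr => k _.
  have i1 := rintegrableZ (y * 2 ^+ k)^-1 (ihi k).
  have i2 := rintegrableZ ((y * 2 ^+ k) ^+ 2)^-1 (ilo k).
  rewrite (RintegralZl _ measurableT (rintegrableD i1 i2)).
  rewrite (RintegralD measurableT i1 i2).
  rewrite (RintegralZl _ measurableT (ihi k)).
  rewrite (RintegralZl _ measurableT (ilo k)).
  by rewrite ![_^-1 * _]mulrC.
rewrite -(RintegralZl _ measurableT fi); apply: le_Rintegral => //.
- exact: rintegrable_sum.
- exact: rintegrableZ.
move=> x _; apply: le_trans (ler_sum_dyadic_split n p12 y0 (cabs_ge0 (f x))).
apply: ler_sum => k _; rewrite /h cabs_high cabs_low_sqr.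
by rewrite ![_^-1 * _]mulrC.
Qed.

Variables (p B : R).
Hypothesis p12 : 1 < p <= 2.
Hypothesis B0 : 0 < B.
Hypothesis u2 : forall i, square_integrable mu (u i).
Hypothesis uoo : forall i, cLp mu +oo%E (u i).
Hypothesis HB : forall (s : seq I) (c : I -> R[i]), uniq s ->
  fine (cLnorm mu 2%:E (fun x => \sum_(i <- s) c i * u i x)) ^+ 2
    <= B * \sum_(i <- s) cabs (c i) ^+ 2.

(** At [p = 2] this is the Bessel constant; for [p < 2] it is the Marcinkiewicz constant, with
    [2 * K] because of the factor 2 in [cabs_cint_le]. *)
Definition paley_cst (K : R) : R :=
  if p == 2 then B else 2 `^ p * (8 * (2 * K) + 4 * B) * dyadic_cst p.

(** [V] is left free so that the same inequality can be used with the sup norms of [v] and with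
    those of [u]. *)
Lemma paley (K : R) (V : I -> R) (s : seq I) (f : T -> R[i]) :
  0 <= K -> uniq s -> (forall i, 0 < V i) ->
  (forall i, Linfnorm mu (u i) <= K * V i) -> cLp mu p%:E f ->
  paley_bounded s (fun i => cabs (FourierLstar mu u f i)) V p
    (paley_cst K * fine (cLnorm mu p%:E f) `^ p).
Proof.
move=> K0 us V0 UV fL phi phi0 TB; have /andP[p1 p2] := p12.
have p0 : 0 < p by exact: lt_trans p1.
have [fi ->] := cLnorm_powR p0 fL; have [mf _] := fL.
(* At [p = 2] the weight has exponent zero and the claim is Bessel's inequality. *)
rewrite /paley_cst; case: eqVneq => [p_2|pn2].
  have f2 : square_integrable mu f by apply/square_integrableP; rewrite -p_2.
  rewrite p_2 cabs_powR2; apply: le_trans (bessel B0 u2 HB us f2).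
  rewrite le_eqVlt; apply/orP; left; apply/eqP; apply: eq_bigr => i _.
  by rewrite subrr powRr0 mulr1 powR_mulrn// cabs_ge0.
have p12' : 1 < p < 2 by rewrite p1 lt_neqAle pn2.
have p02 : 0 < p <= 2 by rewrite p0.
rewrite -mulrA.
apply: (@marcinkiewicz_seq _ _ s p (2 * K) B _ _ V phi
  (fun y => Rintegral mu setT (fun x => cabs (high y f x)))
  (fun y => Rintegral mu setT (fun x => cabs (low y f x) ^+ 2))
  (fun y i => cabs (FourierLstar mu u (low y f) i))) => //.
- by rewrite mulr_ge0.
- by move=> i _; exact: cabs_ge0.
- by move=> y _; apply: Rintegral_ge0 => x _; exact: cabs_ge0.
- by move=> y _; apply: Rintegral_ge0 => x _; exact: sqr_ge0.
- move=> y i y0 _.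
  have hi := rintegrable_high p1 y0 mf fi.
  have lo := square_integrable_low p02 y0 mf fi.
  have mhi := cmeasurable_high y mf.
  have mcu := cmeasurable_conjc (uoo i).1.
  have ubd : {ae mu, forall x, cabs (conjc (u i x)) <= Linfnorm mu (u i)}.
    apply: filterS (ae_le_Linfnorm (uoo i)) => x.
    by rewrite cabs_conjc.
  have [hu hub] := integrable_mul_bounded mhi mcu hi ubd (Linfnorm_ge0 _ _).
  have lu := square_integrable_mul lo (u2 i).
  (* The high part is estimated by its L^1 norm times the sup norm of [u i]; the low part is kept as
     [beta]. *)
  have -> : FourierLstar mu u f i =
      FourierLstar mu u (high y f) i + FourierLstar mu u (low y f) i.
    rewrite /FourierLstar -cintD//; last first.
    - by apply: cmeasurableM => //; exact: lo.1.
    - exact: cmeasurableM.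
    by congr cint; apply/funext => x; rewrite -mulrDl -high_low.
  apply: (le_trans (ler_cabsD _ _)); rewrite lerD2r.
  apply: (le_trans (cabs_cint_le (cmeasurableM mhi mcu) hu)).
  rewrite -!mulrA ler_pM2l//; apply: (le_trans hub); rewrite mulrA.
  apply: ler_wpM2r => //; apply: Rintegral_ge0 => x _; exact: cabs_ge0.
- move=> y y0; apply: bessel => //.
  exact: square_integrable_low p02 y0 mf fi.
- exact: ltW.
- by move=> y n y0; exact: dyadic_truncation_le.
Qed.

End Paley.

Lemma paley_cst_gt0 (R : realType) (p B K : R) :
  1 < p <= 2 -> 0 < B -> 0 <= K -> 0 < paley_cst p B K.
Proof.
move=> /andP[p1 p2] B0 K0; rewrite /paley_cst; case: eqVneq => // pn2.
rewrite mulr_gt0//; last by apply: dyadic_cst_gt0; rewrite p1 lt_neqAle pn2.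
by rewrite mulr_gt0 ?powR_gt0// ltr_wpDl ?mulr_ge0// mulr_gt0.
Qed.

(** * Passage from finite sets of indices to the whole family *)

Lemma Mphi_ge0 (d : measure_display) (T : measurableType d) (R : realType)
    (mu : {measure set T -> \bar R}) (I : choiceType) (v : I -> T -> R[i])
    (phi : I -> R) : (0 <= Mphi mu v phi)%E.
Proof.
apply: (@le_trans _ _ (1%:E * esum [set xi | (1 <= phi xi)%R]
    (fun xi => (Linfnorm mu (v xi) ^+ 2)%:E))%E).
  by rewrite mul1e esum_ge0// => i _; rewrite lee_fin sqr_ge0.
by apply: ereal_sup_ubound; exists 1 => //=; exact: ltr01.
Qed.

Lemma Mphi_tail_bounded (d : measure_display) (T : measurableType d)
    (R : realType) (mu : {measure set T -> \bar R}) (I : choiceType)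
    (v : I -> T -> R[i]) (phi : I -> R) (s : seq I) :
  uniq s -> (Mphi mu v phi < +oo)%E ->
  tail_bounded s (fun xi => Linfnorm mu (v xi)) phi (fine (Mphi mu v phi)).
Proof.
move=> us Moo t t0; rewrite -lee_fin fineK; last first.
  by rewrite ge0_fin_numE// Mphi_ge0.
apply: (@le_trans _ _ (t%:E * esum [set xi | (t <= phi xi)%R]
    (fun xi => (Linfnorm mu (v xi) ^+ 2)%:E))%E); last first.
  by apply: ereal_sup_ubound; exists t.
rewrite EFinM lee_pmul2l// -big_filter -sumEFin.
apply: esum_ge; exists [set` [seq i <- s | t <= phi i]].
  split; first exact: finite_seq.
  by move=> i /=; rewrite mem_filter => /andP[].
by rewrite -fsbig_seq// filter_uniq.
Qed.

Theorem mainTheorem8 (d : measure_display) (T : measurableType d) (R : realType)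
  (mu : {measure set T -> \bar R}) (I : choiceType) (u v : I -> T -> R[i])
  (p : R) :
  sigma_finite [set: T] mu ->
  biorthogonal_system mu u v ->
  1 < p <= 2 ->
  (exists K : R, forall xi, Linfnorm mu (u xi) / Linfnorm mu (v xi) <= K) ->
  exists C : R, 0 < C /\
  forall b : R, p <= b <= dual_exp p ->
  forall phi : I -> R, (forall xi, 0 < phi xi) ->
  (Mphi mu v phi < +oo)%E ->
  forall f : T -> R[i], cLp mu p%:E f ->
  ((esum [set: I] (fun xi =>
      ((cabs (FourierLstar mu u f xi) * phi xi `^ (b^-1 - (dual_exp p)^-1)) `^ b
       * Linfnorm mu (v xi) `^ (1 - b / dual_exp p)
       * Linfnorm mu (u xi) `^ (1 - b / p))%:E)) `^ (b^-1)
   <= C%:E * (Mphi mu v phi `^ (b^-1 - (dual_exp p)^-1))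
      * cLnorm mu p%:E f)%E.
Proof.
move=> _ [norm1 _ [uL2 [[A [B [_ [B0 riesz]]]] _]] uvoo] p12 [K UVK].
have [p1 p2] := andP p12.
have p0 : 0 < p := lt_trans ltr01 p1.
have two0 : 0 < 2 :> R by [].
have U0 xi : 0 < Linfnorm mu (u xi).
  have [uoo _] := uvoo xi; apply: (Linfnorm_gt0 two0) => //.
  by rewrite (norm1 xi).1 onee_eq0.
have V0 xi : 0 < Linfnorm mu (v xi).
  have [_ voo] := uvoo xi; apply: (Linfnorm_gt0 two0) => //.
  by rewrite (norm1 xi).2 onee_eq0.
have u2 xi : square_integrable mu (u xi) by apply/square_integrableP.
have uoo xi : cLp mu +oo%E (u xi) by case: (uvoo xi).
have HB (s : seq I) (c : I -> R[i]) : uniq s ->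
    fine (cLnorm mu 2%:E (fun x => \sum_(i <- s) c i * u i x)) ^+ 2
      <= B * \sum_(i <- s) cabs (c i) ^+ 2.
  by move=> /(riesz s c)/andP[].
(* The maximum with 1 makes one constant valid both for [V = |v|] and for [V = |u|]. *)
pose K1 := Num.max K 1.
have K11 : 1 <= K1 by rewrite le_max lexx orbT.
have K10 : 0 <= K1 by rewrite (le_trans ler01).
have UV xi : Linfnorm mu (u xi) <= K1 * Linfnorm mu (v xi).
  by rewrite -ler_pdivrMr// (le_trans (UVK xi))// le_max lexx.
have UU xi : Linfnorm mu (u xi) <= K1 * Linfnorm mu (u xi).
  by rewrite ler_peMl// ltW.
set P := paley_cst p B K1.
have P0 : 0 < P by exact: paley_cst_gt0.
(* The finite inequality is applied with [C = P * N ^ p], whose [p]-th root is [P ^ p^-1 * N]; [P]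
   depends on neither [b], [phi] nor [f]. *)
exists (P `^ p^-1); split; first exact: powR_gt0.
move=> b pbp' phi phi0 Moo f fL.
have b0 : 0 < b by rewrite (lt_le_trans p0)//; case/andP: pbp'.
set N := fine (cLnorm mu p%:E f); set M := fine (Mphi mu v phi).
have N0 : 0 <= N by rewrite fine_ge0// Lnorm_ge0.
have M0 : 0 <= M by rewrite fine_ge0// Mphi_ge0.
have -> : Mphi mu v phi = M%:E by rewrite fineK// ge0_fin_numE// Mphi_ge0.
have -> : cLnorm mu p%:E f = N%:E.
  by rewrite fineK// ge0_fin_numE ?Lnorm_ge0//; case: fL.
rewrite poweR_EFin -!EFinM; set e := b^-1 - _.
have Z0 : 0 <= P `^ p^-1 * M `^ e * N by rewrite !mulr_ge0 ?powR_ge0.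
(* Monotonicity of the power [b^-1] reduces the claim to a bound on the sum itself. *)
suff S : (esum [set: I] (fun xi =>
      ((cabs (FourierLstar mu u f xi) * phi xi `^ e) `^ b
       * Linfnorm mu (v xi) `^ (1 - b / dual_exp p)
       * Linfnorm mu (u xi) `^ (1 - b / p))%:E)
    <= ((P `^ p^-1 * M `^ e * N) `^ b)%:E)%E.
  have -> : (P `^ p^-1 * M `^ e * N)%:E =
      ((((P `^ p^-1 * M `^ e * N) `^ b)%:E) `^ b^-1)%E.
    by rewrite poweR_EFin -powRrM divff ?gt_eqF// powRr1.
  apply: gt0_ler_poweR => //.
  - by rewrite invr_ge0 ltW.
  - rewrite in_itv /= leey andbT; apply: esum_ge0 => i _.
    by rewrite lee_fin !mulr_ge0 ?powR_ge0.
  - by rewrite in_itv /= leey andbT lee_fin powR_ge0.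
(* The sum is a supremum over finite subsets [F], and the finite estimate has a bound independent of
   [F]. *)
apply: ge_ereal_sup => _ [F [finF _] <-].
rewrite fsbig_finite//= sumEFin lee_fin.
have us := finmap.fset_uniq (fset_set F).
have PU := paley p12 B0 u2 uoo HB K10 us U0 UU fL.
have PV := paley p12 B0 u2 uoo HB K10 us V0 UV fL.
have CP0 : 0 <= P * N `^ p by rewrite mulr_ge0 ?powR_ge0 ?ltW.
have HY := (hausdorff_young_paley p12 pbp' CP0 M0
  (fun i _ => cabs_ge0 _) (fun i _ => U0 i) (fun i _ => V0 i)
  (fun i _ => phi0 i) PU PV (Mphi_tail_bounded us Moo)).
apply: (le_trans HY).
rewrite (powRM p^-1 (ltW P0) (powR_ge0 N p)) -powRrM divff ?gt_eqF// powRr1//.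
by rewrite mulrCA mulrA.
Qed.
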